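(* Let $T$ and $T'$ be non-empty Boolean trusses with decompositions $T\cong T_1\times T_2\times T_3\times T_4$ and $T'\cong T_1'\times T_2'\times T_3'\times T_4'$, where $T_1=\mathrm{T}(A,\circ)$ and $T_1'=\mathrm{T}(A',\circ)$ are circle trusses of Boolean rings $A,A'$; $T_2=\mathrm{T}(B)$ and $T_2'=\mathrm{T}(B')$ for Boolean rings $B,B'$; $T_3,T_3'$ are left zero trusses; and $T_4,T_4'$ are right zero trusses. Then $T$ is isomorphic to $T'$ if and only if $T_1\times T_2\cong T_1'\times T_2'$, $T_3\cong T_3'$ and $T_4\cong T_4'$ (all isomorphisms being isomorphisms of trusses).
   Context: An Abelian heap is a set $H$ with a ternary operation $[-,-,-]$ such that for all $a_1,\dots,a_5\in H$: $[[a_1,a_2,a_3],a_4,a_5]=[a_1,a_2,[a_3,a_4,a_5]]$; $[a_1,a_2,a_2]=a_1$ and $[a_2,a_1,a_1]=a_2$; $[a_1,a_2,a_3]=[a_3,a_2,a_1]$. A truss is an Abelian heap $(T,[-,-,-])$ with an associative binary operation $\cdot$ satisfying $a\cdot[b,c,d]=[a\cdot b,a\cdot c,a\cdot d]$ and $[b,c,d]\cdot a=[b\cdot a,c\cdot a,d\cdot a]$ for all $a,b,c,d\in T$. A truss homomorphism is a map preserving both the ternary operation and the multiplication; an isomorphism is a bijective homomorphism. Direct products carry componentwise operations. A truss $T$ is Boolean if $a^2=a$ for all $a\in T$. Rings are associative and need not be unital; a Boolean ring is a (not necessarily unital) ring in which $x^2=x$ for all $x$. For a ring $R$, $\mathrm{T}(R)$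 is the set $R$ with heap operation $[a,b,c]=a-b+c$ and the ring multiplication; the circle truss $\mathrm{T}(R,\circ)$ is the set $R$ with the same heap operation and multiplication $a\circ b=a+b+ab$. A left zero truss is an Abelian heap with multiplication $a\cdot b=a$ for all $a,b$; a right zero truss is an Abelian heap with multiplication $a\cdot b=b$ for all $a,b$. *)

(* Defs.v *)
From HB Require Import structures.
From mathcomp Require Import all_boot ssralg.

Set Implicit Arguments.
Unset Strict Implicit.
Unset Printing Implicit Defensive.

Import GRing.Theory.
Local Open Scope ring_scope.

(* The empty heap is allowed. The other Mal'cev identity [b, b, a] = a follows
   from heapxKK and heapC. *)
HB.mixin Record isAbelianHeap H := {
  heap : H -> H -> H -> H;
  heapA : forall a b c d e, heap (heap a b c) d e = heap a b (heap c d e);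
  heapxKK : forall a b, heap a b b = a;
  heapC : forall a b c, heap a b c = heap c b a
}.

#[short(type="abelianHeapType")]
HB.structure Definition AbelianHeap := {H of isAbelianHeap H}.

HB.mixin Record AbelianHeap_isTruss T of AbelianHeap T := {
  tmul : T -> T -> T;
  tmulA : associative tmul;
  tmul_heapr : forall a b c d : T,
    tmul a (heap b c d) = heap (tmul a b) (tmul a c) (tmul a d);
  tmul_heapl : forall a b c d : T,
    tmul (heap b c d) a = heap (tmul b a) (tmul c a) (tmul d a)
}.

#[short(type="trussType")]
HB.structure Definition Truss := {T of AbelianHeap_isTruss T & AbelianHeap T}.

Definition truss_hom (T T' : trussType) (f : T -> T') : Prop :=
  (forall a b c, f (heap a b c) = heap (f a) (f b) (f c)) /\
  (forall a b, f (tmul a b) = tmul (f a) (f b)).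

Definition truss_iso (T T' : trussType) : Prop :=
  exists f : T -> T', truss_hom f /\ bijective f.

Definition boolean_truss (T : trussType) : Prop := forall a : T, tmul a a = a.

Definition left_zero_truss (T : trussType) : Prop :=
  forall a b : T, tmul a b = a.

Definition right_zero_truss (T : trussType) : Prop :=
  forall a b : T, tmul a b = b.

Section Product.
Variables T U : trussType.
Implicit Types x y z u v : T * U.

Definition prod_heap x y z := (heap x.1 y.1 z.1, heap x.2 y.2 z.2).
Definition prod_tmul x y := (tmul x.1 y.1, tmul x.2 y.2).

Fact prod_heapA x y z u v :
  prod_heap (prod_heap x y z) u v = prod_heap x y (prod_heap z u v).
Proof. by rewrite /prod_heap /= !heapA. Qed.

Fact prod_heapxKK x y : prod_heap x y y = x.
Proof. by case: x => a b; rewrite /prod_heap /= !heapxKK. Qed.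

Fact prod_heapC x y z : prod_heap x y z = prod_heap z y x.
Proof. by congr pair; apply: heapC. Qed.

HB.instance Definition _ := isAbelianHeap.Build (T * U)%type
  prod_heapA prod_heapxKK prod_heapC.

Fact prod_tmulA : associative prod_tmul.
Proof. by move=> x y z; rewrite /prod_tmul /= !tmulA. Qed.

Fact prod_tmul_heapr x y z u :
  prod_tmul x (heap y z u) =
  heap (prod_tmul x y) (prod_tmul x z) (prod_tmul x u).
Proof. by congr pair; apply: tmul_heapr. Qed.

Fact prod_tmul_heapl x y z u :
  prod_tmul (heap y z u) x =
  heap (prod_tmul y x) (prod_tmul z x) (prod_tmul u x).
Proof. by congr pair; apply: tmul_heapl. Qed.

HB.instance Definition _ := AbelianHeap_isTruss.Build (T * U)%type
  prod_tmulA prod_tmul_heapr prod_tmul_heapl.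

End Product.

(* Associative rings without a required unit; the rings of ssralg all have one.
   Multiplication is the semigroup operation (x * y)%g. *)
Local Notation "x ** y" := (x * y)%g (at level 40, left associativity).

HB.mixin Record Zmodule_Semigroup_isRng R of GRing.Zmodule R & Semigroup R := {
  rngDl : forall x y z : R, (x + y) ** z = x ** z + y ** z;
  rngDr : forall x y z : R, x ** (y + z) = x ** y + x ** z
}.

#[short(type="rngType")]
HB.structure Definition Rng :=
  {R of Zmodule_Semigroup_isRng R & GRing.Zmodule R & Semigroup R}.

Definition boolean_rng (R : rngType) : Prop := forall x : R, x ** x = x.

(* Two aliases of the carrier of R, each carrying its own truss structure. *)
Definition ring_truss (R : rngType) : Type := R.
Definition circle_truss (R : rngType) : Type := R.

Section RingTrusses.
Variable R : rngType.
Implicit Types a b c d e : R.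

Definition ring_heap a b c := a - b + c.
Definition circle a b := a + b + a ** b.

Fact ring_heapA a b c d e :
  ring_heap (ring_heap a b c) d e = ring_heap a b (ring_heap c d e).
Proof. by rewrite /ring_heap !addrA. Qed.

Fact ring_heapxKK a b : ring_heap a b b = a.
Proof. exact: subrK. Qed.

Fact ring_heapC a b c : ring_heap a b c = ring_heap c b a.
Proof. by rewrite /ring_heap -addrA addrC (addrC (- b)). Qed.

Fact rngBl a b c : (a - b) ** c = a ** c - b ** c.
Proof. by apply: (addIr (b ** c)); rewrite -rngDl !subrK. Qed.

Fact rngBr a b c : a ** (b - c) = a ** b - a ** c.
Proof. by apply: (addIr (a ** c)); rewrite -rngDr !subrK. Qed.

Fact rng_mul_heapr a b c d :
  a ** ring_heap b c d = ring_heap (a ** b) (a ** c) (a ** d).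
Proof. by rewrite /ring_heap rngDr rngBr. Qed.

Fact rng_mul_heapl a b c d :
  ring_heap b c d ** a = ring_heap (b ** a) (c ** a) (d ** a).
Proof. by rewrite /ring_heap rngDl rngBl. Qed.

Fact ring_heapD a b c a' b' c' :
  ring_heap a b c + ring_heap a' b' c' =
  ring_heap (a + a') (b + b') (c + c').
Proof. by rewrite /ring_heap addrACA (addrACA a) opprD. Qed.

Fact circleA : associative circle.
Proof.
move=> a b c; rewrite /circle !rngDl !rngDr mulgA !addrA.
by rewrite [LHS](ACl (1*2*5*3*6*4*7)).
Qed.

Fact circle_heapr a b c d :
  circle a (ring_heap b c d) =
  ring_heap (circle a b) (circle a c) (circle a d).
Proof. by rewrite /circle rng_mul_heapr -!ring_heapD ring_heapxKK. Qed.

Fact circle_heapl a b c d :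
  circle (ring_heap b c d) a =
  ring_heap (circle b a) (circle c a) (circle d a).
Proof. by rewrite /circle rng_mul_heapl -!ring_heapD ring_heapxKK. Qed.

HB.instance Definition _ := isAbelianHeap.Build (ring_truss R)
  ring_heapA ring_heapxKK ring_heapC.
HB.instance Definition _ := AbelianHeap_isTruss.Build (ring_truss R)
  (@mulgA R) rng_mul_heapr rng_mul_heapl.

HB.instance Definition _ := isAbelianHeap.Build (circle_truss R)
  ring_heapA ring_heapxKK ring_heapC.
HB.instance Definition _ := AbelianHeap_isTruss.Build (circle_truss R)
  circleA circle_heapr circle_heapl.

End RingTrusses.

(* Main.v *)
Require Import Defs.
From mathcomp Require Import all_boot ssralg.

(** The product T1 * T2 =: C of the first two factors is a commutative
    idempotent truss, so that T is a product C * L * R with L left zero and R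
    right zero, and (c, l, r)(c', l', r') = (cc', l, r'): multiplicatively, a
    semilattice times a rectangular band.  Green's relations of this band can
    be written with products only, hence are respected by every
    homomorphism, and they recover the coordinates:
    - xyx = x and yxy = y      iff x and y have the same C-coordinate;
    - xy = y and yx = x        iff they have the same C- and L-coordinates;
    - xy = x and yx = y        iff they have the same C- and R-coordinates.
    So the C-coordinate of the image of a point under a homomorphism depends
    only on its C-coordinate, and an isomorphism f induces an isomorphism of
    the quotients C and C'.
    The relations only give C * L and C * R as quotients, not L and R.  But for
    a base point x0 = (c0, l0, r0) the slice {c0} * L * R is a subtruss (c0 is
    idempotent), f maps it onto the slice of f x0, and within slices the
    L-coordinate of the image depends only on the L-coordinate.  So
    l |-> (f (c0, l, r0)).1.2 is an isomorphism from L to L', with inverse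
    obtained in the same way from f^-1 and the base point f x0; dually for R.

    Nonemptiness provides the base point, through which each factor embeds in
    the product (coreS, leftS, rightS below).  *)

Set Implicit Arguments.
Unset Strict Implicit.
Unset Printing Implicit Defensive.

Import GRing.Theory.

(** * Isomorphisms of trusses *)

Lemma truss_hom_comp (T U V : trussType) (f : U -> V) (g : T -> U) :
  truss_hom f -> truss_hom g -> truss_hom (f \o g).
Proof.
move=> [fh fm] [gh gm]; split=> [a b c|a b] /=; first by rewrite gh fh.
by rewrite gm fm.
Qed.

Lemma can_truss_hom (T U : trussType) (f : T -> U) (g : U -> T) :
  truss_hom f -> cancel f g -> cancel g f -> truss_hom g.
Proof.
move=> [fh fm] fK gK; split=> [a b c|a b]; apply: (can_inj fK).
  by rewrite fh !gK.
by rewrite fm !gK.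
Qed.

Lemma truss_iso_sym (T U : trussType) : truss_iso T U -> truss_iso U T.
Proof.
case=> f [fhom [g fK gK]]; exists g; split; last by exists f.
exact: can_truss_hom fhom fK gK.
Qed.

Lemma truss_iso_trans (T U V : trussType) :
  truss_iso T U -> truss_iso U V -> truss_iso T V.
Proof.
move=> [f [fhom fbij]] [g [ghom gbij]]; exists (g \o f).
by split; [apply: truss_hom_comp | apply: bij_comp].
Qed.

Lemma truss_iso_prod (T U T' U' : trussType) :
  truss_iso T T' -> truss_iso U U' ->
  truss_iso (T * U)%type (T' * U')%type.
Proof.
move=> [f [[fh fm] [f' fK f'K]]] [g [[gh gm] [g' gK g'K]]].
exists (fun x => (f x.1, g x.2)); split.
  by split=> [a b c|a b]; congr pair; rewrite /= ?fh ?gh ?fm ?gm.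
exists (fun x => (f' x.1, g' x.2)) => -[x y] /=; first by rewrite fK gK.
by rewrite f'K g'K.
Qed.

Lemma truss_hom_pairl (T U : trussType) (u : U) :
  tmul u u = u -> truss_hom (fun t : T => (t, u)).
Proof. by move=> uu; split=> *; congr pair; rewrite /= ?heapxKK ?uu. Qed.

Lemma truss_hom_pairr (T U : trussType) (t : T) :
  tmul t t = t -> truss_hom (fun u : U => (t, u)).
Proof. by move=> tt; split=> *; congr pair; rewrite /= ?heapxKK ?tt. Qed.

(** * Boolean rings give commutative idempotent trusses *)

Section BooleanRng.
Variable R : rngType.
Hypothesis R_boolean : boolean_rng R.
Local Open Scope ring_scope.

(** Expanding (x + y)(x + y) = x + y. *)
Lemma boolean_rng_anticomm (x y : R) : (x * y)%g + (y * x)%g = 0.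
Proof.
have := R_boolean (x + y); rewrite rngDl !rngDr !R_boolean => e.
by apply: (addrI x); apply: (addIr y); rewrite addr0 -[RHS]e !addrA.
Qed.

Lemma boolean_rng_addxx (x : R) : x + x = 0.
Proof. by have := boolean_rng_anticomm x x; rewrite R_boolean. Qed.

Lemma boolean_rng_mulC (x y : R) : (x * y)%g = (y * x)%g.
Proof.
by apply: (addIr (y * x)%g); rewrite boolean_rng_anticomm boolean_rng_addxx.
Qed.

Lemma ring_truss_boolean : boolean_truss (ring_truss R).
Proof. exact: R_boolean. Qed.

Lemma ring_truss_comm : commutative (@tmul (ring_truss R)).
Proof. exact: boolean_rng_mulC. Qed.

Lemma circle_truss_boolean : boolean_truss (circle_truss R).
Proof.
move=> x; change (@circle R x x = x).
by rewrite /circle R_boolean boolean_rng_addxx add0r.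
Qed.

Lemma circle_truss_comm : commutative (@tmul (circle_truss R)).
Proof.
move=> x y; change (@circle R x y = @circle R y x).
by rewrite /circle boolean_rng_mulC (addrC x).
Qed.

End BooleanRng.

Lemma prod_truss_boolean (T U : trussType) :
  boolean_truss T -> boolean_truss U -> boolean_truss (T * U)%type.
Proof. by move=> T_id U_id [t u]; congr pair; [apply: T_id | apply: U_id]. Qed.

Lemma prod_truss_comm (T U : trussType) :
  commutative (@tmul T) -> commutative (@tmul U) ->
  commutative (@tmul (T * U)%type).
Proof. by move=> TC UC x y; congr pair; [apply: TC | apply: UC]. Qed.

(** * Green's relations *)

(** In a truss whose multiplication is idempotent, these are Green's relations
    D, R and L.  *)
Section GreenRelations.
Variable T : trussType.
Implicit Types x y : T.

Definition greenD x y := tmul (tmul x y) x = x /\ tmul (tmul y x) y = y.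
Definition greenR x y := tmul x y = y /\ tmul y x = x.
Definition greenL x y := tmul x y = x /\ tmul y x = y.

End GreenRelations.

Section HomGreen.
Variables (T U : trussType) (f : T -> U).
Hypothesis f_hom : truss_hom f.

Lemma hom_greenD x y : greenD x y -> greenD (f x) (f y).
Proof. by case: f_hom => _ fm [xy yx]; split; rewrite -!fm ?xy ?yx. Qed.

Lemma hom_greenR x y : greenR x y -> greenR (f x) (f y).
Proof. by case: f_hom => _ fm [xy yx]; split; rewrite -!fm ?xy ?yx. Qed.

Lemma hom_greenL x y : greenL x y -> greenL (f x) (f y).
Proof. by case: f_hom => _ fm [xy yx]; split; rewrite -!fm ?xy ?yx. Qed.

End HomGreen.

(** The common shape of the two decompositions to be compared. *)
Definition band_factors (C L R : trussType) : Prop :=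
  [/\ boolean_truss C, commutative (@tmul C),
      left_zero_truss L & right_zero_truss R].

Section BandProduct.
Variables C L R : trussType.
Hypothesis CLR : band_factors C L R.
Implicit Types x y : (C * L * R)%type.

Lemma tmul_band x y :
  tmul x y = (tmul x.1.1 y.1.1, x.1.2, y.2).
Proof.
have [_ _ L_left R_right] := CLR.
by congr (_, _, _); [apply: L_left | apply: R_right].
Qed.

(** In the semilattice C, cc'c = c says that c is below c' and c'cc' = c' the
    converse. *)
Lemma greenD_band x y : greenD x y <-> x.1.1 = y.1.1.
Proof.
have [C_id C_comm _ _] := CLR.
case: x y => [[c l] r] [[c' l'] r'] /=; split=> [[]|<-].
  rewrite !tmul_band /= => -[cc] [c'c].
  transitivity (tmul c c').
    by rewrite -[LHS]cc -tmulA (C_comm c') tmulA C_id.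
  by rewrite -[RHS]c'c -tmulA (C_comm c c') tmulA C_id.
by split; rewrite !tmul_band /= !C_id.
Qed.

Lemma greenR_band x y : greenR x y <-> x.1 = y.1.
Proof.
have [C_id C_comm _ _] := CLR.
case: x y => [[c l] r] [[c' l'] r'] /=; split=> [[]|[<- <-]].
  by rewrite !tmul_band /= => -[cc ->] [c'c]; rewrite -cc C_comm c'c.
by split; rewrite tmul_band /= C_id.
Qed.

Lemma greenL_band x y : greenL x y <-> x.1.1 = y.1.1 /\ x.2 = y.2.
Proof.
have [C_id C_comm _ _] := CLR.
case: x y => [[c l] r] [[c' l'] r'] /=; split=> [[]|[<- <-]].
  by rewrite !tmul_band /= => -[cc ->] [c'c]; rewrite -c'c C_comm cc.
by split; rewrite tmul_band /= C_id.
Qed.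

Definition coreS x c : (C * L * R)%type := (c, x.1.2, x.2).
Definition leftS x l : (C * L * R)%type := (x.1.1, l, x.2).
Definition rightS x r : (C * L * R)%type := (x.1, r).

Definition leftP x : L := x.1.2.

Lemma coreS_hom x : truss_hom (coreS x).
Proof.
have [_ _ L_left R_right] := CLR.
apply: (truss_hom_comp (g := fun c => (c, x.1.2)) (f := fun cl => (cl, x.2))).
  exact/truss_hom_pairl/R_right.
exact/truss_hom_pairl/L_left.
Qed.

Lemma leftS_hom x : truss_hom (leftS x).
Proof.
have [C_id _ _ R_right] := CLR.
apply: (truss_hom_comp (g := fun l => (x.1.1, l)) (f := fun cl => (cl, x.2))).
  exact/truss_hom_pairl/R_right.
exact/truss_hom_pairr/C_id.
Qed.

Lemma rightS_hom x : truss_hom (rightS x).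
Proof.
have [C_id _ L_left _] := CLR.
apply: truss_hom_pairr; case: x => [[c l] r].
by congr pair; [apply: C_id | apply: L_left].
Qed.

End BandProduct.

Section HomBand.
Variables C L R C' L' R' : trussType.
Hypotheses (CLR : band_factors C L R) (CLR' : band_factors C' L' R').
Variable f : (C * L * R)%type -> (C' * L' * R')%type.
Hypothesis f_hom : truss_hom f.
Implicit Types x y : (C * L * R)%type.

Lemma hom_core x y : x.1.1 = y.1.1 -> (f x).1.1 = (f y).1.1.
Proof.
by move/(greenD_band CLR)/(hom_greenD f_hom)/(greenD_band CLR').
Qed.

Lemma hom_core_left x y : x.1 = y.1 -> (f x).1 = (f y).1.
Proof.
by move/(greenR_band CLR)/(hom_greenR f_hom)/(greenR_band CLR').
Qed.

Lemma hom_core_right x y :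
  x.1.1 = y.1.1 -> x.2 = y.2 -> (f x).2 = (f y).2.
Proof.
move=> e1 e2; have /(greenL_band CLR) := conj e1 e2.
by move/(hom_greenL f_hom)/(greenL_band CLR') => [].
Qed.

End HomBand.

(** * Isomorphisms of products induce isomorphisms of the factors *)

(** One half of each induced bijection; exchanging f and g gives the other.
    Going back through g starts from the image point in C' * L' * R' with some
    coordinates reset to those of f x; this does not change the coordinate
    read off at the end, because the reset point and the image point are
    related by the Green relation D, R or L respectively, which g respects. *)
Section InducedCancel.
Variables C L R C' L' R' : trussType.
Hypotheses (CLR : band_factors C L R) (CLR' : band_factors C' L' R').
Variable f : (C * L * R)%type -> (C' * L' * R')%type.
Variable g : (C' * L' * R')%type -> (C * L * R)%type.
Hypotheses (f_hom : truss_hom f) (g_hom : truss_hom g) (fK : cancel f g).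
Variables (x : (C * L * R)%type) (x' : (C' * L' * R')%type).
Hypothesis fx : f x = x'.

Lemma core_cancel :
  cancel (fst \o fst \o f \o coreS x) (fst \o fst \o g \o coreS x').
Proof.
move=> c /=.
have -> : (g (coreS x' (f (coreS x c)).1.1)).1.1 = (g (f (coreS x c))).1.1.
  exact: (hom_core CLR' CLR g_hom).
by rewrite fK.
Qed.

Lemma left_cancel :
  cancel (@leftP C' L' R' \o f \o leftS x) (@leftP C L R \o g \o leftS x').
Proof.
move=> l /=.
have e : (leftS x' (leftP (f (leftS x l)))).1 = (f (leftS x l)).1.
  rewrite /leftS /leftP /= -fx [RHS]surjective_pairing; congr pair.
  exact: (hom_core CLR CLR' f_hom).
by rewrite {1}/leftP (hom_core_left CLR' CLR g_hom e) fK.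
Qed.

Lemma right_cancel :
  cancel (snd \o f \o rightS x) (snd \o g \o rightS x').
Proof.
move=> r /=.
have e : (rightS x' (f (rightS x r)).2).1.1 = (f (rightS x r)).1.1.
  by rewrite /= -fx; apply: (hom_core CLR CLR' f_hom).
by rewrite (hom_core_right CLR' CLR g_hom e) // fK.
Qed.

End InducedCancel.

Lemma band_factors_iso (C L R C' L' R' : trussType) :
  band_factors C L R -> band_factors C' L' R' -> inhabited (C * L * R) ->
  truss_iso (C * L * R)%type (C' * L' * R')%type ->
  [/\ truss_iso C C', truss_iso L L' & truss_iso R R'].
Proof.
move=> CLR CLR' [x] [f [f_hom [g fK gK]]].
have g_hom := can_truss_hom f_hom fK gK; have gfx := fK x.
split.
- exists (fst \o fst \o f \o coreS x); split.
    by apply: truss_hom_comp (coreS_hom CLR x); apply: truss_hom_comp f_hom.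
  by exists (fst \o fst \o g \o coreS (f x)); apply: core_cancel.
- exists (@leftP C' L' R' \o f \o leftS x); split.
    by apply: truss_hom_comp (leftS_hom CLR x); apply: truss_hom_comp f_hom.
  by exists (@leftP C L R \o g \o leftS (f x)); apply: left_cancel.
- exists (snd \o f \o rightS x); split.
    by apply: truss_hom_comp (rightS_hom CLR x); apply: truss_hom_comp f_hom.
  by exists (snd \o g \o rightS (f x)); apply: right_cancel.
Qed.

Lemma boolean_band_factors (A B : rngType) (L R : trussType) :
  boolean_rng A -> boolean_rng B -> left_zero_truss L -> right_zero_truss R ->
  band_factors (circle_truss A * ring_truss B)%type L R.
Proof.
move=> A_boolean B_boolean L_left R_right; split=> //.
  apply: prod_truss_boolean; first exact: circle_truss_boolean.
  exact: ring_truss_boolean.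
by apply: prod_truss_comm; [apply: circle_truss_comm | apply: ring_truss_comm].
Qed.

Theorem theorem3p9
  (T T' : trussType) (A B A' B' : rngType) (T3 T4 T3' T4' : trussType)
  (T_nonempty : inhabited T) (T'_nonempty : inhabited T')
  (T_boolean : boolean_truss T) (T'_boolean : boolean_truss T')
  (A_boolean : boolean_rng A) (B_boolean : boolean_rng B)
  (A'_boolean : boolean_rng A') (B'_boolean : boolean_rng B')
  (T3_left : left_zero_truss T3) (T4_right : right_zero_truss T4)
  (T3'_left : left_zero_truss T3') (T4'_right : right_zero_truss T4')
  (T_decomp :
    truss_iso T (circle_truss A * ring_truss B * T3 * T4)%type)
  (T'_decomp :
    truss_iso T' (circle_truss A' * ring_truss B' * T3' * T4')%type) :
  truss_iso T T' <->
  [/\ truss_iso (circle_truss A * ring_truss B)%type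
                (circle_truss A' * ring_truss B')%type,
      truss_iso T3 T3' & truss_iso T4 T4'].
Proof.
split=> [TT'|[iso12 iso3 iso4]].
  apply: band_factors_iso.
  - exact: boolean_band_factors.
  - exact: boolean_band_factors.
  - by have [t] := T_nonempty; have [f _] := T_decomp; exists; apply: f t.
  - apply: truss_iso_trans T'_decomp; apply: truss_iso_trans TT'.
    exact: truss_iso_sym.
apply: truss_iso_trans (truss_iso_sym T'_decomp).
apply: truss_iso_trans T_decomp _.
by do 2!apply: truss_iso_prod => //.
Qed.
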